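(* Let $\mathcal{T}$ be a family of complete first-order theories in a countable language $\Sigma$ with ${\rm RS}(\mathcal{T})=\infty$, let $\alpha\in\{0,1\}$ and $n\in\omega\setminus\{0\}$. Then there is a set $\Phi$ of $\Sigma$-sentences such that the $d$-definable subfamily $\mathcal{T}_\Phi$ satisfies ${\rm RS}(\mathcal{T}_\Phi)=\alpha$ and ${\rm ds}(\mathcal{T}_\Phi)=n$.
   Context: All languages are predicate (relational) languages. A family of theories is a set $\mathcal{T}$ of complete first-order theories in one language $\Sigma=\Sigma(\mathcal{T})$; each theory is identified with the deductively closed set of $\Sigma$-sentences it contains. For a $\Sigma$-sentence $\varphi$, $\mathcal{T}_\varphi=\{T\in\mathcal{T}\mid\varphi\in T\}$; for a set $\Phi$ of $\Sigma$-sentences, $\mathcal{T}_\Phi=\bigcap_{\varphi\in\Phi}\mathcal{T}_\varphi=\{T\in\mathcal{T}\mid\Phi\subseteq T\}$. A subfamily of the form $\mathcal{T}_\Phi$ is called $d$-definable in $\mathcal{T}$. Rank: ${\rm RS}(\emptyset)=-1$; ${\rm RS}(\mathcal{T})=0$ for finite nonempty $\mathcal{T}$; ${\rm RS}(\mathcal{T})\geq 1$ for infinite $\mathcal{T}$. For $\alpha=\beta+1$, ${\rm RS}(\mathcal{T})\geq\alpha$ if there are pairwise inconsistent $\Sigma$-sentences $\varphi_n$, $n\in\omega$, with ${\rm RS}(\mathcal{T}_{\varphi_n})\geq\beta$ for all $n$. For limit $\alpha$, ${\rm RS}(\mathcal{T})\geq\alpha$ if ${\rm RS}(\mathcal{T})\geq\beta$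 for all $\beta<\alpha$. ${\rm RS}(\mathcal{T})=\alpha$ if ${\rm RS}(\mathcal{T})\geq\alpha$ and ${\rm RS}(\mathcal{T})\not\geq\alpha+1$; ${\rm RS}(\mathcal{T})=\infty$ if ${\rm RS}(\mathcal{T})\geq\alpha$ for every ordinal $\alpha$. Degree: if ${\rm RS}(\mathcal{T})=\alpha\ge 0$ is an ordinal, ${\rm ds}(\mathcal{T})$ is the maximal number of pairwise inconsistent $\Sigma$-sentences $\varphi_i$ with ${\rm RS}(\mathcal{T}_{\varphi_i})=\alpha$. *)

(* Defs.v *)
From HB Require Import structures.
From mathcomp Require Import all_boot.
From mathcomp Require Import boolp classical_sets functions cardinality.

Set Implicit Arguments.
Unset Strict Implicit.
Unset Printing Implicit Defensive.

Local Open Scope classical_set_scope.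

Record language := Language { symb : Type; arity : symb -> nat }.

(* Formulas of first-order logic with equality whose free variables are among
   the n de Bruijn indices 'I_n; under a quantifier, index 0 is the variable
   just bound. *)
Inductive formula (Sigma : language) (n : nat) : Type :=
| Eq of 'I_n & 'I_n
| Rel (P : symb Sigma) of (arity P).-tuple 'I_n
| Not of formula Sigma n
| And of formula Sigma n & formula Sigma n
| Or of formula Sigma n & formula Sigma n
| Imp of formula Sigma n & formula Sigma n
| All of formula Sigma n.+1
| Ex of formula Sigma n.+1.

Definition sentence (Sigma : language) := formula Sigma 0.

Record structure (Sigma : language) := Structure {
  dom : Type;
  dom_inhabited : inhabited dom;
  interp : forall P : symb Sigma, (arity P).-tuple dom -> Prop }.

Definition extend (D : Type) (n : nat) (x : D) (e : 'I_n -> D)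
    (i : 'I_n.+1) : D :=
  if unlift ord0 i is Some j then e j else x.

Fixpoint sat (Sigma : language) (M : structure Sigma) (n : nat)
    (f : formula Sigma n) : ('I_n -> dom M) -> Prop :=
  match f with
  | Eq i j => fun e => e i = e j
  | Rel P t => fun e => interp (map_tuple e t)
  | Not g => fun e => ~ sat g e
  | And g h => fun e => sat g e /\ sat h e
  | Or g h => fun e => sat g e \/ sat h e
  | Imp g h => fun e => sat g e -> sat h e
  | All g => fun e => forall x, sat g (extend x e)
  | Ex g => fun e => exists x, sat g (extend x e)
  end.

Definition no_var (D : Type) (i : 'I_0) : D :=
  False_rect D (notF (ltn_ord i)).

Definition models (Sigma : language) (M : structure Sigma)
    (phi : sentence Sigma) : Prop :=
  sat phi (@no_var (dom M)).

Definition is_model (Sigma : language) (M : structure Sigma)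
    (Phi : set (sentence Sigma)) : Prop :=
  forall phi, Phi phi -> models M phi.

Definition consistent (Sigma : language) (Phi : set (sentence Sigma)) : Prop :=
  exists M : structure Sigma, is_model M Phi.

Definition entails (Sigma : language) (Phi : set (sentence Sigma))
    (phi : sentence Sigma) : Prop :=
  forall M : structure Sigma, is_model M Phi -> models M phi.

Definition complete_theory (Sigma : language) (T : set (sentence Sigma)) : Prop :=
  [/\ consistent T,
      forall phi, entails T phi -> T phi
    & forall phi, T phi \/ T (Not phi)].

Definition theory_family (Sigma : language)
    (F : set (set (sentence Sigma))) : Prop :=
  forall T, F T -> complete_theory T.

Definition subfamily (Sigma : language) (F : set (set (sentence Sigma)))
    (phi : sentence Sigma) : set (set (sentence Sigma)) :=
  [set T | F T /\ T phi].

Definition d_subfamily (Sigma : language) (F : set (set (sentence Sigma)))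
    (Phi : set (sentence Sigma)) : set (set (sentence Sigma)) :=
  [set T | F T /\ Phi `<=` T].

Definition pairwise_inconsistent (Sigma : language) (I : Type)
    (phi : I -> sentence Sigma) : Prop :=
  forall i j, i <> j -> ~ consistent [set phi i; phi j].

(* An ordinal is represented by an element a of a well-order (the order type of
   the elements below a). The well-order is required to have no greatest
   element so that a + 1 is again represented in it; every ordinal is
   represented in some such well-order. *)
Record wellorder := WellOrder {
  wo_sort :> Type;
  wo_lt : wo_sort -> wo_sort -> Prop;
  wo_wf : well_founded wo_lt;
  wo_trans : forall a b c, wo_lt a b -> wo_lt b c -> wo_lt a c;
  wo_total : forall a b, [\/ wo_lt a b, a = b | wo_lt b a];
  wo_unbounded : forall a, exists b, wo_lt a b }.

Definition is_zero (W : wellorder) (a : W) : Prop := forall b, ~ wo_lt b a.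

Definition is_succ (W : wellorder) (b a : W) : Prop :=
  wo_lt b a /\ forall c, ~ (wo_lt b c /\ wo_lt c a).

Definition is_limit (W : wellorder) (a : W) : Prop :=
  ~ is_zero a /\ forall b, ~ is_succ b a.

(* RS F >= a. The value RS F = -1 is the failure of RS F >= 0. *)
Inductive RS_ge (Sigma : language) (W : wellorder) :
    W -> set (set (sentence Sigma)) -> Prop :=
| RS_ge_zero (a : W) F : is_zero a -> F !=set0 -> RS_ge a F
| RS_ge_one (b a : W) F :
    is_zero b -> is_succ b a -> infinite_set F -> RS_ge a F
| RS_ge_succ (b a : W) F (phi : nat -> sentence Sigma) :
    is_succ b a -> pairwise_inconsistent phi ->
    (forall n, RS_ge b (subfamily F (phi n))) -> RS_ge a F
| RS_ge_limit (a : W) F :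
    is_limit a -> (forall b, wo_lt b a -> RS_ge b F) -> RS_ge a F.

Definition RS_eq (Sigma : language) (W : wellorder)
    (F : set (set (sentence Sigma))) (a : W) : Prop :=
  RS_ge a F /\ forall a', is_succ a a' -> ~ RS_ge a' F.

Definition RS_infty (Sigma : language) (F : set (set (sentence Sigma))) : Prop :=
  forall (W : wellorder) (a : W), RS_ge a F.

Definition rank_splits (Sigma : language) (W : wellorder)
    (F : set (set (sentence Sigma))) (a : W) (m : nat) : Prop :=
  exists phi : 'I_m -> sentence Sigma,
    pairwise_inconsistent phi /\ forall i, RS_eq (subfamily F (phi i)) a.

(* ds F = n for a family F of rank a. *)
Definition ds_eq (Sigma : language) (W : wellorder)
    (F : set (set (sentence Sigma))) (a : W) (n : nat) : Prop :=
  [/\ RS_eq F a,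
      rank_splits F a n
    & forall m, rank_splits F a m -> m <= n].

Definition nat_lt (m n : nat) : Prop := m < n.

Lemma nat_lt_wf : well_founded nat_lt.
Proof.
move=> n; elim/ltn_ind: n => n IHn.
exact: (Acc_intro _ (fun m lt_mn => IHn m lt_mn)).
Qed.

Lemma nat_lt_trans a b c : nat_lt a b -> nat_lt b c -> nat_lt a c.
Proof. exact: ltn_trans. Qed.

Lemma nat_lt_total a b : [\/ nat_lt a b, a = b | nat_lt b a].
Proof. by case: (ltngtP a b) => ?; [apply: Or31 | apply: Or33 | apply: Or32]. Qed.

Lemma nat_lt_unbounded a : exists b, nat_lt a b.
Proof. by exists a.+1; rewrite /nat_lt. Qed.

(* The finite ordinals. *)
Definition omega : wellorder :=
  WellOrder nat_lt_wf nat_lt_trans nat_lt_total nat_lt_unbounded.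

(* Main.v *)
Require Import Defs.
From HB Require Import structures.
From mathcomp Require Import all_boot.
From mathcomp Require Import boolp classical_sets functions cardinality.

Set Implicit Arguments.
Unset Strict Implicit.
Unset Printing Implicit Defensive.

Local Open Scope classical_set_scope.

(** Think of F as a subspace of the Stone space of complete theories: sentences
    are clopen sets, and the d-definable subfamilies are the traces on F of
    closed sets.  Infinite rank gives pairwise inconsistent sentences phi_k
    such that each F_phi_k is infinite.  For alpha = 0 pick one theory T_i in
    F_phi_i for each i < n; for alpha = 1 pick a sequence of distinct theories
    in F_phi_i that converges, i.e. such that every sentence is decided in the
    same way by all but finitely many of its terms.  There are countably many
    sentences, so a diagonal argument yields such a sequence
    (almost_decided_subset).  Its limit need not belong to F.

    Let X_i be the set of theories picked in F_phi_i, let Y be the union of the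
    X_i, and let Phi be the set of sentences common to all members of Y, so that
    F_Phi is the trace on F of the closure of Y.  A theory in the closure of a
    finite set belongs to it, because finitely many other theories can be
    separated from it by one sentence; hence a clopen set meeting Y in a finite
    set contains no other point of F_Phi (d_subfamily_common_theory).

    Call a family small if it is empty (alpha = 0) or finite (alpha = 1): on
    families of complete theories this is the failure of rank at least alpha
    (RS_geP).  Each X_i is irreducible: it is not small, and no sentence cuts it
    into two families that are not small.  So a sentence psi for which
    (F_Phi)_psi is not small contains some X_i up to a small part, and two
    inconsistent sentences cannot do this for the same i.  Therefore at most n
    pairwise inconsistent sentences cut families of rank at least alpha out of
    F_Phi (inconsistent_sections_bound).  This bounds the degree by n, and for
    alpha = 1 it also bounds the rank by 1, as rank 2 would supply infinitely
    many such sentences.  For alpha = 0 the rank is bounded because F_Phi is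
    finite.  The sentences phi_0, ..., phi_(n-1) show that the degree n is
    attained. *)

(** * Countability of the set of sentences *)

Fixpoint formula_code (Sigma : language) (c : symb Sigma -> nat) (n : nat)
    (f : formula Sigma n) : GenTree.tree nat :=
  match f with
  | Eq i j => GenTree.Node 0 [:: GenTree.Leaf (i : nat); GenTree.Leaf (j : nat)]
  | Rel P t => GenTree.Node 1
      [:: GenTree.Leaf (c P); GenTree.Leaf (pickle (t : seq 'I_n))]
  | Not g => GenTree.Node 2 [:: formula_code c g]
  | And g h => GenTree.Node 3 [:: formula_code c g; formula_code c h]
  | Or g h => GenTree.Node 4 [:: formula_code c g; formula_code c h]
  | Imp g h => GenTree.Node 5 [:: formula_code c g; formula_code c h]
  | All g => GenTree.Node 6 [:: formula_code c g]
  | Ex g => GenTree.Node 7 [:: formula_code c g]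
  end.

Lemma formula_code_inj (Sigma : language) (c : symb Sigma -> nat) (n : nat) :
  injective c -> injective (@formula_code Sigma c n).
Proof.
move=> c_inj f; elim: f => {n}.
- by move=> n i j [] //= i' j' [/val_inj-> /val_inj->].
- move=> n P t [] //= Q u [/c_inj PQ]; case: Q / PQ u => u.
  by move=> /(pcan_inj pickleK)/val_inj->.
- by move=> n g IHg [] //= g' [/IHg->].
- by move=> n g IHg h IHh [] //= g' h' [/IHg-> /IHh->].
- by move=> n g IHg h IHh [] //= g' h' [/IHg-> /IHh->].
- by move=> n g IHg h IHh [] //= g' h' [/IHg-> /IHh->].
- by move=> n g IHg [] //= g' [/IHg->].
- by move=> n g IHg [] //= g' [/IHg->].
Qed.

Lemma sentence_injection (Sigma : language) :
  countable [set: symb Sigma] -> exists c : sentence Sigma -> nat, injective c.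
Proof.
move=> /countable_injP[c c_inj].
exists (pickle \o @formula_code Sigma c 0).
apply: inj_comp; first exact: (pcan_inj pickleK).
by apply: formula_code_inj => P Q; apply: c_inj; rewrite in_setT.
Qed.

(** * Almost decided infinite subsets *)

(** At each step the half of the current set to keep is an infinite one, with
    preference for the part inside A k. *)
Fixpoint thinning (T : Type) (A : nat -> set T) (S : set T) (k : nat) : set T :=
  if k is k'.+1 then
    let S' := thinning A S k' in
    if `[< infinite_set (S' `&` A k') >] then S' `&` A k' else S' `\` A k'
  else S.

(** The list of points picked so far, most recent first; the default x0 is
    returned only if no new point of S k is left. *)
Fixpoint diagonal (T : choiceType) (x0 : T) (S : nat -> set T) (k : nat) :
    seq T :=
  if k is k'.+1 then
    let s := diagonal x0 S k' in xget x0 (S k `\` [set` s]) :: s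
  else [::].

Lemma thinningS (T : Type) (A : nat -> set T) (S : set T) (k : nat) :
  thinning A S k.+1 `<=` thinning A S k.
Proof. by move=> x /=; case: ifP => _ []. Qed.

Lemma thinning_infinite (T : Type) (A : nat -> set T) (S : set T) (k : nat) :
  infinite_set S -> infinite_set (thinning A S k).
Proof.
move=> Sinf; elim: k => //= k IHk; case: asboolP => // /contrapT fin.
move: IHk; rewrite -{1}(setUIDK (thinning A S k) (A k)) finite_setU => IHk fin'.
exact: IHk.
Qed.

(** A pseudo-intersection: the n-th point of the diagonal lies in the n-th
    thinning, and the thinnings decrease, so that all but the first k+1 points
    are on the same side of A k. *)
Lemma almost_decided_subset (T : choiceType) (A : nat -> set T) (S : set T) :
  infinite_set S ->
  exists X : set T, [/\ X `<=` S, infinite_set X &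
    forall k, finite_set (X `&` A k) \/ finite_set (X `\` A k)].
Proof.
move=> Sinf; have [x0 _] := infinite_setN0 Sinf.
pose St := thinning A S; pose d := diagonal x0 St.
have new k : (St k.+1 `\` [set` d k]) (xget x0 (St k.+1 `\` [set` d k])).
  apply: xgetPex; apply: infinite_setN0; apply: infinite_setD.
    exact: thinning_infinite.
  by apply/finite_seqP; exists (d k).
have d_mono k j : {subset d k <= d (k + j)}.
  elim: j => [|j IHj] x; first by rewrite addn0.
  by rewrite addnS /= inE => /IHj->; rewrite orbT.
have St_mono k j : St (k + j) `<=` St k.
  elim: j => [|j IHj] x; first by rewrite addn0.
  by rewrite addnS => Stx; apply: IHj; exact: thinningS Stx.
have tail k j x : x \in d j -> x \in d k \/ St k x.
  have [jk|kj] := leqP j k.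
    by move=> xd; left; rewrite -(subnKC jk); exact: d_mono.
  rewrite -(subnKC (ltnW kj)); elim: (j - k) => [|i IHi].
    by rewrite addn0; left.
  rewrite addnS /= inE => /orP[/eqP->|]; last exact: IHi.
  by right; case: (new (k + i)) => + _; rewrite -addnS; apply: St_mono.
have d_uniq k : uniq (d k) /\ size (d k) = k.
  elim: k => //= k [-> ->]; split=> //; rewrite andbT.
  by apply/negP; case: (new k).
exists [set x | exists k, x \in d k]; split.
- move=> x [k /(tail 0)[]//].
- move=> /finite_seqP[s sE].
  have /uniq_leq_size : uniq (d (size s).+1) by case: (d_uniq (size s).+1).
  move=> /(_ s) => le_s; suff: size (d (size s).+1) <= size s.
    by case: (d_uniq (size s).+1) => _ ->; rewrite ltnn.
  apply: le_s => x xd; suff: [set` s] x by [].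
  by rewrite -sE; exists (size s).+1.
- move=> k; have dfin : finite_set [set` d k.+1].
    by apply/finite_seqP; exists (d k.+1).
  have := @thinningS; move: tail => /(_ k.+1); rewrite /St /=.
  case: asboolP => _ tail _; [right|left]; apply: sub_finite_set dfin => x.
    by move=> [[j /tail[//|[]]]].
  by move=> [[j /tail[//|[]]]].
Qed.

(** * Complete theories *)

Lemma complete_theory_of_model (Sigma : language) (T : set (sentence Sigma)) :
  complete_theory T -> exists M, forall phi, T phi <-> models M phi.
Proof.
move=> [[M MT] _ Tc]; exists M => phi; split; first exact: MT.
by move=> Mphi; have [//|/MT] := Tc phi.
Qed.

Section CompleteTheory.
Variables (Sigma : language) (T : set (sentence Sigma)).
Hypothesis Tcomp : complete_theory T.

Lemma complete_Not phi : T (Not phi) <-> ~ T phi.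
Proof.
have [M TM] := complete_theory_of_model Tcomp.
by rewrite TM /models /= -/(models M phi) -TM.
Qed.

Lemma complete_Or phi psi : T (Or phi psi) <-> T phi \/ T psi.
Proof.
have [M TM] := complete_theory_of_model Tcomp.
by rewrite TM /models /= -/(models M phi) -/(models M psi) -!TM.
Qed.

Lemma complete_consistent2 phi psi :
  T phi -> T psi -> consistent [set phi; psi].
Proof.
have [M TM] := complete_theory_of_model Tcomp.
by move=> /TM Mphi /TM Mpsi; exists M => chi [->|->].
Qed.

Lemma complete_maximal T' : complete_theory T' -> T `<=` T' -> T = T'.
Proof.
move=> T'comp sub; apply/seteqP; split=> // phi T'phi.
apply: contrapT => /complete_Not/sub.
have [M TM] := complete_theory_of_model T'comp.
by move=> /TM; apply; apply/TM.
Qed.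

End CompleteTheory.

(** A disjunction of sentences, one for each member of s, that T omits: two
    distinct complete theories are incomparable by maximality, and a complete
    theory omits a disjunction when it omits both disjuncts. *)
Lemma separating_sentence (Sigma : language) (T : set (sentence Sigma))
    (s : seq (set (sentence Sigma))) :
  complete_theory T -> (forall T', T' \in s -> complete_theory T') ->
  T \notin s -> exists chi, ~ T chi /\ forall T', T' \in s -> T' chi.
Proof.
move=> Tcomp; elim: s => [|T' s IHs] scomp.
  move=> _; pose phi : sentence Sigma := All (Eq Sigma ord0 ord0).
  have [Tphi|nTphi] := pselect (T phi); last by exists phi.
  by exists (Not phi); split=> // /(complete_Not Tcomp).
rewrite inE negb_or => /andP[/eqP neq Ts].
have T'comp : complete_theory T' by apply: scomp; rewrite mem_head.
have [|//|chi [nTchi schi]] := IHs.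
  by move=> T'' sT''; apply: scomp; rewrite inE sT'' orbT.
have [chi' T'chi' nTchi'] : exists2 chi', T' chi' & ~ T chi'.
  apply: contrapT => none; apply: neq; apply/esym/complete_maximal => //.
  by move=> phi T'phi; apply: contrapT => nT; apply: none; exists phi.
exists (Or chi' chi); split; first by move=> /(complete_Or Tcomp)[].
move=> T''; rewrite inE => /orP[/eqP->|sT''].
  by apply/(complete_Or T'comp); left.
apply/complete_Or; first by apply: scomp; rewrite inE sT'' orbT.
by right; exact: schi.
Qed.

Lemma theory_family_sub (Sigma : language) (F G : set (set (sentence Sigma))) :
  G `<=` F -> theory_family F -> theory_family G.
Proof. by move=> GF Fth T /GF/Fth. Qed.

(** The closed set of theories extending common_theory Y is the closure of Y in
    the Stone space. *)
Definition common_theory (Sigma : language) (Y : set (set (sentence Sigma))) :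
    set (sentence Sigma) :=
  [set phi | forall T, Y T -> T phi].

(** Points of the closure of Y in the clopen set psi are in the closure of
    the members of Y lying in psi, and a finite set is closed.  Concretely, if
    chi is in all these members but not in T, then the sentence
    (not psi or chi) is in all of Y, hence in T, a contradiction. *)
Lemma d_subfamily_common_theory (Sigma : language)
    (F Y : set (set (sentence Sigma))) (psi : sentence Sigma) :
  theory_family F -> Y `<=` F -> finite_set (subfamily Y psi) ->
  subfamily (d_subfamily F (common_theory Y)) psi `<=` subfamily Y psi.
Proof.
move=> Fth YF /finite_seqP[s sE] T [[FT YT] Tpsi].
have sY T' : T' \in s -> subfamily Y psi T' by rewrite sE.
suff: T \in s by move/sY.
apply/negPn/negP => /separating_sentence[||chi [nTchi schi]].
- exact: Fth.
- by move=> T' /sY[/YF/Fth].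
apply: nTchi; have Tcomp := Fth _ FT.
have : T (Or (Not psi) chi).
  apply: YT => T' YT'; have T'comp := Fth _ (YF _ YT').
  apply/(complete_Or T'comp).
  have [T'psi|nT'psi] := pselect (T' psi); last first.
    by left; apply/(complete_Not T'comp).
  by right; apply: schi; suff: [set` s] T' by []; rewrite -sE.
by move=> /(complete_Or Tcomp)[/(complete_Not Tcomp)|].
Qed.

(** * Ranks 0, 1 and 2 *)

Lemma RS_ge_sub (Sigma : language) (W : wellorder) (a : W)
    (F G : set (set (sentence Sigma))) :
  F `<=` G -> RS_ge a F -> RS_ge a G.
Proof.
move=> FG RSF; elim: RSF G FG => {a F}.
- by move=> a F a0 [T FT] G FG; apply: RS_ge_zero => //; exists T; exact: FG.
- move=> b a F b0 ba Finf G FG.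
  exact: RS_ge_one b0 ba (sub_infinite_set FG Finf).
- move=> b a F phi ba inc _ IH G FG; apply: RS_ge_succ ba inc _ => n.
  by apply: (IH n) => T [/FG GT Tphi].
- by move=> a F alim _ IH G FG; apply: RS_ge_limit alim _ => b /IH; apply.
Qed.

Lemma omega_is_zero (a : omega) : is_zero a <-> a = 0.
Proof.
split=> [a0|-> b]; last by rewrite /= /nat_lt ltn0.
by case: a a0 => // a /(_ a); rewrite /= /nat_lt ltnSn.
Qed.

Lemma omega_is_succ (b a : omega) : is_succ b a <-> a = b.+1.
Proof.
split=> [[+ nob]|->]; rewrite /= /nat_lt.
  rewrite leq_eqVlt => /orP[/eqP//|lt].
  by case: (nob b.+1); split; [exact: ltnSn|].
by split=> [|c [bc cb]]; [exact: ltnSn|have := leq_trans bc cb; rewrite ltnn].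
Qed.

Lemma RS_ge0P (Sigma : language) (F : set (set (sentence Sigma))) :
  RS_ge (0 : omega) F <-> F !=set0.
Proof.
split=> [|Fn0]; last by apply: RS_ge_zero => //; apply/omega_is_zero.
move aE: (0 : omega) => a RSF; case: RSF aE => {a F} //.
- by move=> b a F _ /omega_is_succ-> _.
- by move=> b a F phi /omega_is_succ->.
- by move=> a F [+ _] _ => /[swap] <- []; apply/omega_is_zero.
Qed.

(** The first alternative is needed because infinite families have rank at
    least 1 outright, whereas the successor clause asks for a splitting. *)
Lemma RS_geSE (Sigma : language) (a : omega) (F : set (set (sentence Sigma))) :
  RS_ge (a.+1 : omega) F ->
  (a = 0 /\ infinite_set F) \/
  exists2 phi : nat -> sentence Sigma,
    pairwise_inconsistent phi & forall k, RS_ge a (subfamily F (phi k)).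
Proof.
move bE: (a.+1 : omega) => b RSF; case: RSF bE => {b F}.
- by move=> b F /omega_is_zero->.
- by move=> b' b F /omega_is_zero-> /omega_is_succ-> Finf [->]; left.
- by move=> b' b F phi /omega_is_succ-> inc RSF [->]; right; exists phi.
- by move=> b F [_ +] _ bE => /(_ a)[]; apply/omega_is_succ.
Qed.

(** Theories chosen in the sections are distinct, since one consistent theory
    cannot contain two inconsistent sentences. *)
Lemma infinite_inconsistent_sections (Sigma : language)
    (F : set (set (sentence Sigma))) (phi : nat -> sentence Sigma) :
  theory_family F -> pairwise_inconsistent phi ->
  (forall k, subfamily F (phi k) !=set0) -> infinite_set F.
Proof.
move=> Fth inc /choice[T TP].
have T_inj : injective T.
  move=> j k Tjk; apply: contrapT => /inc; apply.
  have [FT Tj] := TP j; have [_ Tk] := TP k.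
  by apply: (complete_consistent2 (Fth _ FT)) => //; rewrite Tjk.
apply/infiniteP; have <- : T @^-1` F = [set: nat].
  by apply/seteqP; split=> // k _; case: (TP k).
by apply: card_ge_preimage => j k _ _; exact: T_inj.
Qed.

Lemma RS_ge1P (Sigma : language) (F : set (set (sentence Sigma))) :
  theory_family F -> RS_ge (1 : omega) F <-> infinite_set F.
Proof.
move=> Fth; split=> [/RS_geSE[[]//|[phi inc RSF]]|Finf].
  apply: (infinite_inconsistent_sections Fth inc) => k.
  by apply/RS_ge0P.
exact: RS_ge_one ((omega_is_zero 0).2 erefl) ((omega_is_succ 0 1).2 erefl) Finf.
Qed.

(** * Small families and irreducible families *)

(** The ideals of empty and of finite sets, handled together so that ranks 0 and
    1 have one proof; only the values alpha = 0 and alpha = 1 are meaningful. *)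
Definition small (T : Type) (alpha : nat) (A : set T) : Prop :=
  if alpha is 0 then A = set0 else finite_set A.

Lemma small_finite (T : Type) (alpha : nat) (A : set T) :
  small alpha A -> finite_set A.
Proof. by case: alpha => //= ->. Qed.

Lemma small_sub (T : Type) (alpha : nat) (A B : set T) :
  A `<=` B -> small alpha B -> small alpha A.
Proof.
by case: alpha => [|alpha] /= AB; [move=> BE; rewrite BE subset0 in AB|
  exact: sub_finite_set].
Qed.

Lemma small_bigcup (T : Type) (I : finType) (alpha : nat) (A : I -> set T) :
  (forall i, small alpha (A i)) -> small alpha (\bigcup_i A i).
Proof.
case: alpha => [|alpha] /= Asm; first by apply: bigcup0 => i _.
by apply: bigcup_finite => //; exact: finite_finset.
Qed.

Lemma small_setU (T : Type) (alpha : nat) (A B : set T) :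
  small alpha A -> small alpha B -> small alpha (A `|` B).
Proof.
case: alpha => [|alpha] /=; first by move=> -> ->; rewrite setU0.
by rewrite finite_setU.
Qed.

Lemma RS_geP (Sigma : language) (alpha : omega)
    (F : set (set (sentence Sigma))) :
  alpha = 0 \/ alpha = 1 -> theory_family F ->
  RS_ge alpha F <-> ~ small alpha F.
Proof.
case=> -> Fth; last exact: RS_ge1P.
by rewrite RS_ge0P; split=> [/set0P/eqP//|/eqP/set0P].
Qed.

(** For alpha = 0 this means a single theory, for alpha = 1 an infinite
    family that converges to one point of the Stone space. *)
Definition irreducible (Sigma : language) (alpha : nat)
    (X : set (set (sentence Sigma))) : Prop :=
  ~ small alpha X /\ forall psi,
    small alpha (subfamily X psi) \/ small alpha (X `\` [set T | T psi]).

(** The extra conclusion for alpha = 0 is what makes the closure of a finite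
    union of such families finite. *)
Lemma irreducible_exists (Sigma : language) (alpha : nat)
    (S : set (set (sentence Sigma))) :
  countable [set: symb Sigma] -> infinite_set S ->
  exists X, [/\ X `<=` S, irreducible alpha X & alpha = 0 -> finite_set X].
Proof.
move=> /sentence_injection[c c_inj] Sinf; case: alpha => [|alpha].
  have [T ST] := infinite_setN0 Sinf; exists [set T]; split.
  - by move=> _ ->.
  - split=> [/= /seteqP[/(_ T erefl)]|psi] //=.
    have [Tpsi|nTpsi] := pselect (T psi); [right|left].
      by rewrite -subset0 => _ [->].
    by rewrite -subset0 => _ [->].
  - by move=> _; exact: finite_set1.
(* indexing by codes turns the sentences into a sequence of sets *)
pose A k := [set T : set (sentence Sigma) | exists2 psi, c psi = k & T psi].
have AE psi : A (c psi) = [set T | T psi].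
  by apply/seteqP; split=> T /=; [case=> phi /c_inj->|exists psi].
have [X [XS Xinf dec]] := almost_decided_subset A Sinf.
by exists X; split=> //; split=> // psi; have := dec (c psi); rewrite AE.
Qed.

Section DegreeBound.
Variables (Sigma : language) (alpha n : nat) (F : set (set (sentence Sigma))).
Variables (X : 'I_n -> set (set (sentence Sigma))).
Hypotheses (Fth : theory_family F) (XF : forall i, X i `<=` F).
Hypothesis Xirr : forall i, irreducible alpha (X i).
Let G := d_subfamily F (common_theory (\bigcup_i X i)).

(** The union Y of the X i is then small in the clopen set psi, hence finite
    there, so that passing to its closure adds nothing in psi. *)
Lemma subfamily_small (psi : sentence Sigma) :
  (forall i, small alpha (subfamily (X i) psi)) -> small alpha (subfamily G psi).
Proof.
move=> sm; have sm' : small alpha (subfamily (\bigcup_i X i) psi).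
  apply: small_sub (small_bigcup sm) => T [[i _ XT] Tpsi].
  by exists i.
apply: (small_sub _ sm').
apply: d_subfamily_common_theory (small_finite sm') => //.
by move=> T [i _ /XF].
Qed.

(** Each psi j contains some X (f j) up to a small part; if f j = f k with psi j
    and psi k inconsistent, then X (f j) is covered by two small sets. *)
Lemma inconsistent_sections_bound (m : nat) (psi : 'I_m -> sentence Sigma) :
  pairwise_inconsistent psi -> (forall j, ~ small alpha (subfamily G (psi j))) ->
  m <= n.
Proof.
move=> inc big.
have /choice[f fP] (j : 'I_m) :
    exists i, small alpha (X i `\` [set T | T (psi j)]).
  apply: contrapT => none; apply: (big j); apply: subfamily_small => i.
  by have [_ /(_ (psi j))[//|sm]] := Xirr i; case: none; exists i.
suff f_inj : injective f.
  by rewrite -[m]card_ord -[n]card_ord; exact: leq_card f_inj.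
move=> j k fjk; apply: contrapT => /inc none.
have [Xbig _] := Xirr (f j); apply: Xbig.
have fPk := fP k; rewrite -fjk in fPk.
apply: small_sub (small_setU (fP j) fPk) => T XT.
have Tcomp := Fth (XF XT).
have [Tj|] := pselect (T (psi j)); last by left.
have [Tk|] := pselect (T (psi k)); last by right.
by case: none; exact: complete_consistent2 Tcomp _ _ Tj Tk.
Qed.

End DegreeBound.

(** * Closures of n irreducible families *)

Theorem theorem4p6 (Sigma : language) (F : set (set (sentence Sigma)))
    (alpha : omega) (n : nat)
    (countable_Sigma : countable [set: symb Sigma])
    (familyF : theory_family F)
    (RSF : RS_infty F)
    (alpha01 : alpha = 0 \/ alpha = 1)
    (n_neq0 : n <> 0) :
  exists Phi : set (sentence Sigma),
    RS_eq (d_subfamily F Phi) alpha /\ ds_eq (d_subfamily F Phi) alpha n.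
Proof.
have [[]//|[phi inc RSphi]] := RS_geSE (RSF omega 2).
have subF psi : theory_family (subfamily F psi).
  by apply: theory_family_sub familyF => T [].
have /choice[X0 X0P] k := irreducible_exists alpha countable_Sigma
  ((RS_ge1P (subF (phi k))).1 (RSphi k)).
pose X (i : 'I_n) := X0 i.
have XP i : [/\ X i `<=` subfamily F (phi i), irreducible alpha (X i)
    & alpha = 0 -> finite_set (X i)] by exact: X0P.
have XF i : X i `<=` F by case: (XP i) => XFphi _ _ T /XFphi[].
have Xirr i : irreducible alpha (X i) by case: (XP i).
pose Y := \bigcup_i X i.
pose G := d_subfamily F (common_theory Y).
have XG i : X i `<=` subfamily G (phi i).
  move=> T XT; case: (XP i) => /(_ T XT)[FT Tphi] _ _.
  by do 2!split=> //; move=> psi; apply; exists i.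
have Gth : theory_family G by apply: theory_family_sub familyF => T [].
have subG psi : theory_family (subfamily G psi).
  by apply: theory_family_sub Gth => T [].
have big (i : 'I_n) : RS_ge alpha (subfamily G (phi i)).
  apply/RS_geP => // sm; have [Xbig _] := Xirr i.
  exact: Xbig (small_sub (@XG i) sm).
have not_geS : ~ RS_ge (alpha.+1 : omega) G.
  move=> /RS_geSE[[alpha0 Ginf]|[psi psi_inc RSpsi]].
    apply: Ginf; have Yfin : finite_set Y.
      apply: bigcup_finite => [|i _]; first exact: finite_finset.
      by case: (XP i) => _ _; apply.
    (* a valid sentence makes the closure lemma speak of all of G *)
    pose top : sentence Sigma := All (Eq Sigma ord0 ord0).
    have topF T : F T -> T top.
      move=> /familyF/complete_theory_of_model[M TM].
      by apply/TM => x.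
    have Ytop_fin : finite_set (subfamily Y top).
      by apply: sub_finite_set Yfin => T [].
    have YF : Y `<=` F by move=> T [i _ /XF].
    apply: (sub_finite_set _ Ytop_fin) => T GT.
    apply: (d_subfamily_common_theory familyF YF Ytop_fin).
    by split=> //; case: GT => /topF.
  (* of infinitely many inconsistent sentences, n + 1 are already too many *)
  have: n.+1 <= n; last by rewrite ltnn.
  apply: (inconsistent_sections_bound familyF XF Xirr (psi := psi \o val)).
    by move=> i j neq; apply: psi_inc => /val_inj.
  by move=> j; apply/(RS_geP alpha01 (subG _))/RSpsi.
have RS_G H : H `<=` G -> RS_ge alpha H -> RS_eq H alpha.
  move=> HG RSH; split=> // a /omega_is_succ-> RSH'.
  exact: not_geS (RS_ge_sub HG RSH').
exists (common_theory Y).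
have RSG : RS_eq G alpha.
  apply: RS_G => //; have n_gt0 : 0 < n by rewrite lt0n; exact/eqP.
  by apply: RS_ge_sub (big (Ordinal n_gt0)) => T [].
split=> //; split=> //.
  exists (phi \o val); split; first by move=> i j neq; apply: inc => /val_inj.
  by move=> i; apply: RS_G (big i) => T [].
move=> m [psi [psi_inc RSpsi]].
apply: (inconsistent_sections_bound familyF XF Xirr psi_inc) => j.
by apply/(RS_geP alpha01 (subG _)); case: (RSpsi j).
Qed.
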